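(* Let $m\ge 1$ and $n=2m$. In $\mathbb{R}^{n+1}$, with coordinates indexed by $\{0,1,\dots,n\}$ and standard unit vectors $e_0,\dots,e_n$, let $q_1=e_1+e_2$ and $q_j=e_{2j-2}+e_{2j-1}+e_{2j}$ for $j=2,\dots,m$, and let $$L_m=\Bigl\{Y\in\mathbb{S}^{n+1}\ \Big|\ Y_{00}=1,\ \ Y_{ii}=Y_{0i}\ (i=1,\dots,n),\ \ \langle q_jq_j^T,Y\rangle=0\ (j=1,\dots,m)\Bigr\}.$$ Then the SDP relaxation $L_m\cap\mathbb{S}^{n+1}_+$ has singularity degree two.
   Context: $\mathbb{S}^p$ is the space of real symmetric $p\times p$ matrices with inner product $\langle X,Y\rangle=\operatorname{tr}(XY)$, and $\mathbb{S}^p_+$ is the positive semidefinite cone. For a set $S$ of matrices (including an affine subspace), $S^\perp=\{Z\mid\langle Z,X\rangle=0\ \forall X\in S\}$. Facial reduction. Let $L\subseteq\mathbb{S}^N$ be an affine subspace with $L\cap\mathbb{S}^N_+\ne\varnothing$. Slater's condition holds if $L$ contains a positive definite matrix. If it fails, a facial-reduction step chooses a nonzero exposing matrix $W\in L^\perp\cap\mathbb{S}^N_+$, takes a matrix $V\in\mathbb{R}^{N\times r}$ whose columns form a basis of $\ker(W)$, and replaces the problem by the reduced problem $\widetilde L\cap\mathbb{S}^r_+$ with $\widetilde L=\{R\in\mathbb{S}^r\mid VRV^T\in L\}$; the corresponding face of $\mathbb{S}^N_+$ is $\mathbb{S}^N_+\cap W^\perp=\{VRV^T\mid R\in\mathbb{S}^r_+\}$,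 which contains the feasible set. Steps are repeated on the reduced problem until the current reduced problem satisfies Slater's condition, at which point the corresponding face of the original cone is the minimal face of $\mathbb{S}^N_+$ containing the original feasible set. The singularity degree of $L\cap\mathbb{S}^N_+$ is the minimum number of facial-reduction steps (over all choices of exposing matrices) required to reach this minimal face. *)

(* Defs.v *)
From mathcomp Require Import all_boot all_order all_algebra.
From mathcomp Require Import boolp classical_sets reals convex.

Set Implicit Arguments.
Unset Strict Implicit.
Unset Printing Implicit Defensive.

Import Order.TTheory GRing.Theory Num.Theory.
Local Open Scope classical_set_scope.
Local Open Scope ring_scope.

Definition mxdot (R : realType) (N : nat) (X Y : 'M[R]_N) : R := \tr (X *m Y).

Definition psd (R : realType) (N : nat) : set 'M[R]_N :=
  [set X | X \is symmetricmx /\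
           forall x : 'cV[R]_N, 0 <= (x^T *m X *m x) 0 0].

Definition posdef (R : realType) (N : nat) : set 'M[R]_N :=
  [set X | X \is symmetricmx /\
           forall x : 'cV[R]_N, x != 0 -> 0 < (x^T *m X *m x) 0 0].

Definition orthosym (R : realType) (N : nat) (S : set 'M[R]_N) : set 'M[R]_N :=
  [set Z | Z \is symmetricmx /\ forall X, S X -> mxdot Z X = 0].

(* Nonemptiness is not included. *)
Definition affine_sym (R : realType) (N : nat) (L : set 'M[R]_N) : Prop :=
  (forall X, L X -> X \is symmetricmx) /\
  (forall X Y (t : R), L X -> L Y -> L (t *: X + (1 - t) *: Y)).

Definition feasible (R : realType) (N : nat) (L : set 'M[R]_N) : set 'M[R]_N :=
  L `&` @psd R N.

Definition slater (R : realType) (N : nat) (L : set 'M[R]_N) : Prop :=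
  exists X, L X /\ @posdef R N X.

(* MathComp vectors are row vectors: kermx W^T spans the transposes of the
   columns x with W *m x = 0. *)
Definition ker_basis (R : realType) (N r : nat)
    (W : 'M[R]_N) (V : 'M[R]_(N, r)) : Prop :=
  row_free V^T /\ (V^T == kermx W^T)%MS.

Definition reduced (R : realType) (N r : nat)
    (L : set 'M[R]_N) (V : 'M[R]_(N, r)) : set 'M[R]_r :=
  [set Q | Q \is symmetricmx /\ L (V *m Q *m V^T)].

Definition fr_step (R : realType) (N r : nat)
    (L : set 'M[R]_N) (V : 'M[R]_(N, r)) : Prop :=
  ~ slater L /\
  exists W : 'M[R]_N,
    [/\ W != 0, orthosym L W, @psd R N W & ker_basis W V].

(* F is the face of the N x N semidefinite cone corresponding to the reduced
   problem obtained from L by some sequence of k facial-reduction steps; each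
   reduced problem's face is transported back by Q |-> V Q V^T. *)
Fixpoint fr_face (R : realType) (k N : nat) (L F : set 'M[R]_N) : Prop :=
  if k is k'.+1 then
    exists (r : nat) (V : 'M[R]_(N, r)) (G : set 'M[R]_r),
      [/\ fr_step L V, fr_face k' (reduced L V) G &
          F = [set V *m Q *m V^T | Q in G]]
  else F = @psd R N.

Definition face (R : realType) (N : nat) (K F : set 'M[R]_N) : Prop :=
  [/\ F `<=` K, convex_set F &
      forall X Y (t : R), K X -> K Y -> 0 < t -> t < 1 ->
        F (t *: X + (1 - t) *: Y) -> F X /\ F Y].

(* [smallest] is the intersection of all faces containing the feasible set,
   which is itself a face. *)
Definition minimal_face (R : realType) (N : nat) (L : set 'M[R]_N) :
    set 'M[R]_N :=
  smallest (face (@psd R N)) (feasible L).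

Definition has_singularity_degree (R : realType) (N : nat)
    (L : set 'M[R]_N) (d : nat) : Prop :=
  [/\ affine_sym L, feasible L !=set0,
      fr_face d L (minimal_face L) &
      forall k, fr_face k L (minimal_face L) -> (d <= k)%N].

(* evec R m i is the standard unit vector e_i of R^{2m+1}; inord is only used
   at indices i <= 2m. *)
Definition evec (R : realType) (m i : nat) : 'cV[R]_((2 * m).+1) :=
  delta_mx (inord i) 0.

Definition qvec (R : realType) (m j : nat) : 'cV[R]_((2 * m).+1) :=
  if j == 1%N then evec R m 1 + evec R m 2
  else evec R m (2 * j - 2) + evec R m (2 * j - 1) + evec R m (2 * j).

Definition Lset (R : realType) (m : nat) : set 'M[R]_((2 * m).+1) :=
  [set Y | [/\ Y \is symmetricmx,
               Y ord0 ord0 = 1,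
               (forall i, i != ord0 -> Y i i = Y ord0 i) &
               (forall j, (1 <= j <= m)%N ->
                  mxdot (qvec R m j *m (qvec R m j)^T) Y = 0)]].

(* Main.v *)
Require Import Defs.
From mathcomp Require Import all_boot all_order all_algebra.
From mathcomp Require Import boolp classical_sets reals convex.
From mathcomp Require Import interval_inference ring lra zify.

(* Put c = q_1 + ... + q_m, so c_0 = 0 and c_i > 0 for i > 0.  If Y in L
   satisfies Y q_j = 0 for all j, then
   sum_i c_i Y_ii = sum_i c_i Y_0i = sum_j (Y q_j)_0 = 0.
   Hence E_00 is the only feasible point and the minimal face is its ray.

   Two steps suffice: expose first with sum_j q_j q_j^T, which forces
   Y q_j = 0; then Diag(c), compressed to the kernel of the first exposing
   matrix, is orthogonal to the reduced problem, and its kernel is e_0.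

   One step is not enough: x = e_{n-1} - e_n is orthogonal to e_0 and to all
   q_j, and with d_i = x_i^2 the indefinite matrix
   Y = x x^T + E_00 + e_0 d^T + d e_0^T lies in L.  A semidefinite W in L^perp
   satisfies W e_0 = 0, because E_00 is in L, so <W, Y> = 0 gives x^T W x = 0
   and W x = 0.  Thus every first face contains x x^T, which is not on the
   ray of E_00. *)

(** * Quadratic forms and semidefinite matrices *)

Section QuadraticForms.
Set Implicit Arguments.
Unset Strict Implicit.
Import Order.TTheory GRing.Theory Num.Theory.
Local Open Scope classical_set_scope.
Local Open Scope ring_scope.
Variable R : realType.

Definition qform N (A : 'M[R]_N) (x : 'cV[R]_N) : R := (x^T *m A *m x) 0 0.

Lemma symmetricmxP N (A : 'M[R]_N) : reflect (A^T = A) (A \is symmetricmx).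
Proof.
rewrite is_hermitianmxE expr0 scale1r map_mx_id //.
by apply: (iffP eqP) => /esym.
Qed.

Lemma bilin_sym N (A : 'M[R]_N) (x y : 'cV[R]_N) : A^T = A ->
  (x^T *m A *m y) 0 0 = (y^T *m A *m x) 0 0.
Proof.
move=> sA; transitivity ((x^T *m A *m y)^T 0 0); first by rewrite [RHS]mxE.
by rewrite !trmx_mul trmxK sA mulmxA.
Qed.

Lemma dotE N (x y : 'cV[R]_N) : (x^T *m y) 0 0 = \sum_i x i 0 * y i 0.
Proof. by rewrite mxE; apply: eq_bigr => i _; rewrite mxE. Qed.

Lemma dot_delta N (x : 'cV[R]_N) k :
  (x^T *m delta_mx k (0 : 'I_1)) 0 0 = x k 0.
Proof. by rewrite -colE 2!mxE. Qed.

Lemma sumr_ge0_eq0 (I : finType) (F : I -> R) :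
  (forall i, 0 <= F i) -> \sum_i F i = 0 -> forall i, F i = 0.
Proof. by move=> F0 s0 i; apply: (psumr_eq0P _ s0). Qed.

Lemma outerE N (x y : 'cV[R]_N) i j : (x *m y^T) i j = x i 0 * y j 0.
Proof. by rewrite mxE big_ord1 mxE. Qed.

Lemma sqnorm_gt0 N (x : 'cV[R]_N) : x != 0 -> 0 < (x^T *m x) 0 0.
Proof.
move=> x0; rewrite dotE lt_neqAle sumr_ge0 ?andbT => [|i _]; last first.
  by rewrite -expr2 sqr_ge0.
apply: contra_neq x0 => /esym s0; apply/matrixP => i j; rewrite ord1 mxE.
have p0 k : 0 <= x k 0 * x k 0 by rewrite -expr2 sqr_ge0.
by have /eqP := sumr_ge0_eq0 p0 s0 i; rewrite mulf_eq0 orbb => /eqP.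
Qed.

Lemma qformD N (A B : 'M[R]_N) x : qform (A + B) x = qform A x + qform B x.
Proof. by rewrite /qform mulmxDr mulmxDl mxE. Qed.

Lemma qformZ N (A : 'M[R]_N) t x : qform (t *: A) x = t * qform A x.
Proof. by rewrite /qform -scalemxAr -scalemxAl mxE. Qed.

Lemma qform_outer N (u x : 'cV[R]_N) :
  qform (u *m u^T) x = (u^T *m x) 0 0 ^+ 2.
Proof.
rewrite /qform mulmxA -mulmxA mxE big_ord1 expr2; congr (_ * _).
by rewrite !dotE; apply: eq_bigr => i _; rewrite mulrC.
Qed.

Lemma qform_congr N r (A : 'M[R]_N) (V : 'M[R]_(N, r)) y :
  qform (V^T *m A *m V) y = qform A (V *m y).
Proof. by rewrite /qform trmx_mul !mulmxA. Qed.

Lemma qform_diag N (d : 'rV[R]_N) x :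
  qform (diag_mx d) x = \sum_i d 0 i * x i 0 ^+ 2.
Proof.
rewrite /qform -mulmxA dotE; apply: eq_bigr => i _.
by rewrite mul_diag_mx mxE expr2 mulrCA.
Qed.

Lemma mxdotC N (A B : 'M[R]_N) : mxdot A B = mxdot B A.
Proof. exact: mxtrace_mulC. Qed.

Lemma mxdotD N (A B C : 'M[R]_N) : mxdot A (B + C) = mxdot A B + mxdot A C.
Proof. by rewrite /mxdot mulmxDr mxtraceD. Qed.

Lemma mxdot_outer2 N (A : 'M[R]_N) (x y : 'cV[R]_N) :
  mxdot A (x *m y^T) = (y^T *m A *m x) 0 0.
Proof. by rewrite /mxdot mulmxA mxtrace_mulC mulmxA trace_mx11. Qed.

Lemma mxdot_outer N (x : 'cV[R]_N) (A : 'M[R]_N) :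
  mxdot (x *m x^T) A = qform A x.
Proof. by rewrite mxdotC mxdot_outer2. Qed.

Lemma mxdot_congr N r (A : 'M[R]_N) (V : 'M[R]_(N, r)) Q :
  mxdot (V^T *m A *m V) Q = mxdot A (V *m Q *m V^T).
Proof. by rewrite /mxdot -!mulmxA mxtrace_mulC !mulmxA. Qed.

Lemma mxdot_diag N (d : 'rV[R]_N) (Y : 'M[R]_N) :
  mxdot (diag_mx d) Y = \sum_i d 0 i * Y i i.
Proof. by apply: eq_bigr => i _; rewrite mul_diag_mx mxE. Qed.

Lemma qform_line N (A : 'M[R]_N) (x y : 'cV[R]_N) t : A^T = A ->
  qform A (x + t *: y) =
    qform A x + 2 * t * (y^T *m A *m x) 0 0 + t ^+ 2 * qform A y.
Proof.
move=> sA; rewrite /qform (_ : (x + _)^T = x^T + t *: y^T); last first.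
  by rewrite linearD linearZ.
rewrite mulmxDr !mulmxDl -!(scalemxAl, scalemxAr).
have := bilin_sym x y sA.
move: (x^T *m A *m x) (x^T *m A *m y) (y^T *m A *m x) (y^T *m A *m y).
by move=> a b c d bc; rewrite !mxE bc; ring.
Qed.

(** Along each line [x + t *: y] the form is a nonnegative polynomial in [t] without constant term,
    so its linear coefficient vanishes. *)
Lemma psd_ker N (A : 'M[R]_N) x : psd A -> qform A x = 0 -> A *m x = 0.
Proof.
case=> /symmetricmxP sA pA qx.
suff z (y : 'cV[R]_N) : (y^T *m A *m x) 0 0 = 0.
  apply/matrixP => i j; rewrite ord1; have := z (delta_mx i 0).
  by rewrite -mulmxA trmx_delta -rowE mxE => ->; rewrite mxE.
pose a : R := (y^T *m A *m x) 0 0; pose b : R := qform A y.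
have b0 : 0 <= b := pA y.
have qt t : 0 <= 2 * t * a + t ^+ 2 * b.
  have := pA (x + t *: y); rewrite -/(qform _ _) qform_line // qx.
  by rewrite -/a -/b add0r; lra.
(* The denominator is [b + 1] rather than [b] because [b] may be zero; the value at this [t] is
   negative unless [a = 0]. *)
have := qt (- a / (b + 1)).
have bn : b + 1 != 0 by apply: lt0r_neq0; lra.
have -> : 2 * (- a / (b + 1)) * a + (- a / (b + 1)) ^+ 2 * b =
  - ((a / (b + 1)) ^+ 2 * (b + 2)) by field.
rewrite oppr_ge0 => h; apply/eqP; rewrite -/a; apply: contraTT h => a0.
by rewrite -ltNge mulr_gt0 ?exprn_even_gt0 ?mulf_neq0 ?invr_eq0 //; lra.
Qed.

Lemma qform_delta N (A : 'M[R]_N) i : qform A (delta_mx i 0) = A i i.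
Proof. by rewrite /qform trmx_delta -rowE -colE !mxE. Qed.

Lemma psd_diag_ge0 N (A : 'M[R]_N) i : psd A -> 0 <= A i i.
Proof. by case=> _ /(_ (delta_mx i 0)); rewrite -/(qform _ _) qform_delta. Qed.

Lemma psd_sym N (A : 'M[R]_N) : psd A -> A^T = A.
Proof. by case=> /symmetricmxP. Qed.

Lemma psd_diag0 N (A : 'M[R]_N) i j : psd A -> A i i = 0 -> A j i = 0.
Proof.
move=> pA Ai; have /(psd_ker pA) : qform A (delta_mx i 0) = 0.
  by rewrite qform_delta.
by rewrite -colE => /matrixP/(_ j 0); rewrite !mxE.
Qed.

Lemma psd_outer N (x : 'cV[R]_N) : psd (x *m x^T).
Proof.
split=> [|y]; first by apply/symmetricmxP; rewrite trmx_mul trmxK.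
by rewrite -/(qform _ _) qform_outer sqr_ge0.
Qed.

Lemma psd_congr N r (A : 'M[R]_N) (V : 'M[R]_(N, r)) :
  psd A -> psd (V^T *m A *m V).
Proof.
move=> pA; split=> [|y].
  by apply/symmetricmxP; rewrite !trmx_mul trmxK (psd_sym pA) mulmxA.
by rewrite -/(qform _ _) qform_congr; case: pA => _ ->.
Qed.

Lemma posdef_psd N (A : 'M[R]_N) : posdef A -> psd A.
Proof.
case=> sA pA; split=> // x; have [->|/pA/ltW //] := eqVneq x 0.
by rewrite mulmx0 mxE.
Qed.

Lemma psd_diag N (d : 'rV[R]_N) : (forall i, 0 <= d 0 i) -> psd (diag_mx d).
Proof.
move=> d0; split=> [|x]; first by apply/symmetricmxP; rewrite tr_diag_mx.
rewrite -/(qform _ _) qform_diag sumr_ge0 // => i _.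
by rewrite mulr_ge0 ?sqr_ge0.
Qed.

Lemma qform0 N (x : 'cV[R]_N) : qform 0 x = 0.
Proof. by rewrite /qform mulmx0 mul0mx mxE. Qed.

(** * Bases of kernels, in column form *)

Lemma ker_basis_mul N r (W : 'M[R]_N) (V : 'M[R]_(N, r)) :
  ker_basis W V -> W *m V = 0.
Proof.
case=> _ /andP[+ _]; rewrite sub_kermx -trmx_mul => /eqP h.
by apply: trmx_inj; rewrite h trmx0.
Qed.

Lemma ker_basis_lift N r (W : 'M[R]_N) (V : 'M[R]_(N, r)) (x : 'cV[R]_N) :
  ker_basis W V -> W *m x = 0 -> exists y, x = V *m y.
Proof.
case=> _ /andP[_ kV] Wx.
have /submx_trans/(_ kV)/submxP[D xD] : (x^T <= kermx W^T)%MS.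
  by rewrite sub_kermx -trmx_mul Wx trmx0.
by exists D^T; apply: trmx_inj; rewrite trmx_mul trmxK.
Qed.

Lemma ker_basis_inj N r (W : 'M[R]_N) (V : 'M[R]_(N, r)) (y z : 'cV[R]_r) :
  ker_basis W V -> V *m y = V *m z -> y = z.
Proof.
case=> fV _ yz; apply: trmx_inj; apply: (row_free_inj fV) => /=.
by rewrite -!trmx_mul yz.
Qed.

Lemma ker_basis_exists N (W : 'M[R]_N) :
  exists r (V : 'M[R]_(N, r)), ker_basis W V.
Proof.
exists _, (row_base (kermx W^T))^T; split; rewrite trmxK ?row_base_free //.
by apply/eqmxP/eq_row_base.
Qed.

End QuadraticForms.

(** * The vectors [qv j] and the test vector [xv] *)

Section Relaxation.
Set Implicit Arguments.
Unset Strict Implicit.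
Import Order.TTheory GRing.Theory Num.Theory.
Local Open Scope classical_set_scope.
Local Open Scope ring_scope.
Variables (R : realType) (m : nat).
Hypothesis m_gt0 : (0 < m)%N.

Local Notation n1 := (2 * m).+1.
Local Notation L := (@Lset R m).
Local Notation E00 := (delta_mx ord0 ord0 : 'M[R]_n1).
Local Notation e0 := (delta_mx ord0 0 : 'cV[R]_n1).

(* The paper's q_{j+1}: indices are shifted to 'I_m. *)
Definition qv (j : 'I_m) : 'cV[R]_n1 := qvec R m j.+1.

Lemma evecE k (i : 'I_n1) : (k <= 2 * m)%N -> evec R m k i 0 = (val i == k)%:R.
Proof. by move=> km; rewrite mxE andbT -val_eqE /= inordK. Qed.

(** The guard [0 < j] accounts for the shorter first vector: at [j = 0] the leading index [2 * j]
    would be that of [e0]. *)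
Lemma qvE (j : 'I_m) (i : 'I_n1) :
  qv j i 0 = ((val i == 2 * j) && (0 < j))%N%:R + (val i == (2 * j).+1)%:R
             + (val i == (2 * j).+2)%:R.
Proof.
have jm := ltn_ord j; rewrite /qv /qvec eqSS; case: eqP => [j0|/eqP j0].
  by rewrite j0 mxE !evecE ?andbF ?add0r //; lia.
rewrite 2!mxE !evecE; try lia.
by rewrite lt0n j0 andbT; congr (_%:R + _%:R + _%:R); lia.
Qed.

Lemma qv_ge0 j i : 0 <= qv j i 0.
Proof. by rewrite qvE !addr_ge0. Qed.

Lemma qv_ord0 j : qv j ord0 0 = 0.
Proof.
rewrite qvE /= !addr0 (_ : (_ == _)%N && _ = false) //; lia.
Qed.

Lemma qv_cover (i : 'I_n1) : i != ord0 -> exists j, 0 < qv j i 0.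
Proof.
move=> i0; have i_gt0 : (0 < i)%N by rewrite lt0n.
(* The pairs [2 * j + 1], [2 * j + 2] partition the nonzero indices, and [i] lies in the pair
   numbered [i.-1./2]. *)
have im : (i.-1./2 < m)%N by have := ltn_ord i; lia.
exists (Ordinal im); rewrite qvE /=.
rewrite -!natrD ltr0n; have [io|ie] := boolP (odd i).
  rewrite (_ : (val i == _.+1) = true); [lia | apply/eqP => /=; lia].
rewrite (_ : (val i == _.+2) = true); [lia | apply/eqP => /=; lia].
Qed.

Definition xv : 'cV[R]_n1 := evec R m (2 * m).-1 - evec R m (2 * m).

Lemma xvE (i : 'I_n1) :
  xv i 0 = (val i == (2 * m).-1)%:R - (val i == 2 * m)%N%:R.
Proof. by rewrite /xv mxE [X in _ + X]mxE !evecE // leq_pred. Qed.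

Lemma xv_ord0 : xv ord0 0 = 0.
Proof.
have [n0 p0] : (0 == 2 * m)%N = false /\ (0 == (2 * m).-1)%N = false by lia.
by rewrite xvE /= n0 p0 subrr.
Qed.

Lemma xv_max : xv ord_max 0 = -1.
Proof.
have p0 : (2 * m == (2 * m).-1)%N = false by lia.
by rewrite xvE /= eqxx p0 sub0r.
Qed.

Lemma ord_max_neq0 : ord_max != ord0 :> 'I_n1.
Proof. by rewrite -val_eqE /= -lt0n; lia. Qed.

Lemma xv_neq0 : xv != 0.
Proof.
apply/eqP => /matrixP/(_ ord_max 0); rewrite xv_max mxE => /eqP.
by rewrite oppr_eq0 oner_eq0.
Qed.

(** The last two indices occur only in the last [qv j], both with coefficient one, so the two signs
    in [xv] cancel. *)
Lemma qv_xv j : ((qv j)^T *m xv) 0 0 = 0.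
Proof.
have jm := ltn_ord j.
rewrite mulmxBr mxE [X in _ + X]mxE !dot_delta !qvE /= !inordK; try lia.
rewrite -!natrD; apply/eqP; rewrite subr_eq0; apply/eqP; congr _%:R; lia.
Qed.

(** * The affine space and its only feasible point *)

Lemma LsetP Y : L Y <->
  [/\ Y^T = Y, Y ord0 ord0 = 1, forall i, i != ord0 -> Y i i = Y ord0 i &
      forall j, qform Y (qv j) = 0].
Proof.
split=> [[/symmetricmxP sY Y0 Yd Yq]|[sY Y0 Yd Yq]]; split=> //.
- by move=> j; rewrite -mxdot_outer Yq //= ltn_ord.
- exact/symmetricmxP.
- move=> [//|j] jm; rewrite mxdot_outer.
  exact: (Yq (Ordinal jm)).
Qed.

Lemma Lset_affine : affine_sym L.
Proof.
split=> [X [//]|X Y t /LsetP[sX X0 Xd Xq] /LsetP[sY Y0 Yd Yq]].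
apply/LsetP; split.
- by rewrite linearD !linearZ /= sX sY.
- by rewrite !mxE X0 Y0; ring.
- by move=> i i0; rewrite !mxE Xd // Yd.
- by move=> j; rewrite qformD !qformZ Xq Yq !mulr0 addr0.
Qed.

Lemma E00E : E00 = e0 *m e0^T.
Proof. by rewrite trmx_delta mul_delta_mx. Qed.

Lemma qform_E00 x : qform E00 x = x ord0 0 ^+ 2.
Proof.
by rewrite E00E qform_outer trmx_delta -rowE mxE.
Qed.

Lemma psd_E00 : psd E00.
Proof. by rewrite E00E; exact: psd_outer. Qed.

Lemma Lset_E00 : L E00.
Proof.
apply/LsetP; split.
- by rewrite trmx_delta.
- by rewrite mxE !eqxx.
- by move=> i /negPf i0; rewrite !mxE i0 andbF.
- by move=> j; rewrite qform_E00 qv_ord0 expr0n.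
Qed.

Definition csum : 'rV[R]_n1 := \row_i \sum_j qv j i 0.

Lemma csum_ord0 : csum 0 ord0 = 0.
Proof. by rewrite mxE big1 // => j _; rewrite qv_ord0. Qed.

Lemma csum_ge0 i : 0 <= csum 0 i.
Proof. by rewrite mxE sumr_ge0 // => j _; exact: qv_ge0. Qed.

Lemma csum_gt0 i : i != ord0 -> 0 < csum 0 i.
Proof.
move=> /qv_cover[j qj]; rewrite mxE (bigD1 j) //= ltr_pwDl //.
by rewrite sumr_ge0 // => k _; exact: qv_ge0.
Qed.

(* The constraints Y_ii = Y_0i turn sum_i c_i Y_ii into
   sum_i c_i Y_0i = sum_j (Y q_j)_0. *)
Lemma mxdot_csum Y : L Y -> (forall j, Y *m qv j = 0) ->
  mxdot (diag_mx csum) Y = 0.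
Proof.
move=> /LsetP[_ _ Yd _] Yq; rewrite mxdot_diag.
transitivity (\sum_i \sum_j Y ord0 i * qv j i 0).
  apply: eq_bigr => i _; rewrite -mulr_sumr.
  have [->|/Yd ->] := eqVneq i ord0; last by rewrite mxE mulrC.
  rewrite csum_ord0 mul0r big1 ?mulr0 // => j _; exact: qv_ord0.
rewrite exchange_big big1 //= => j _.
by have /matrixP/(_ ord0 0) := Yq j; rewrite !mxE.
Qed.

Lemma psd_supported0 (Y : 'M[R]_n1) : psd Y ->
  (forall i, i != ord0 -> Y i i = 0) -> Y = Y ord0 ord0 *: E00.
Proof.
move=> pY Yd; apply/matrixP => i j; rewrite 2!mxE.
have [->|j0] := eqVneq j ord0; last first.
  by rewrite andbF mulr0 (psd_diag0 _ pY (Yd j j0)).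
have [->|i0] := eqVneq i ord0; first by rewrite mulr1.
by rewrite mulr0 -(psd_sym pY) mxE (psd_diag0 _ pY (Yd i i0)).
Qed.

Lemma feasible_Lset : feasible L = [set E00].
Proof.
apply/seteqP; split=> [Y [LY pY]|_ ->]; last first.
  by split; [exact: Lset_E00 | exact: psd_E00].
have /LsetP[_ Y0 _ Yq] := LY.
(* Semidefiniteness upgrades the scalar constraints on [Y] to [Y *m qv j = 0]. *)
have := mxdot_csum LY (fun j => psd_ker pY (Yq j)).
rewrite mxdot_diag => s0 /=.
rewrite (psd_supported0 pY) ?Y0 ?scale1r // => i i0.
have p k : 0 <= csum 0 k * Y k k.
  by rewrite mulr_ge0 ?csum_ge0 ?psd_diag_ge0.
have /eqP := sumr_ge0_eq0 p s0 i.
by rewrite mulf_eq0 gt_eqF ?csum_gt0 //= => /eqP.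
Qed.

(** * The minimal face *)

Definition ray : set 'M[R]_n1 := [set s *: E00 | s in [set s : R | 0 <= s]].

Lemma ray_psd : ray `<=` @psd R n1.
Proof.
move=> _ [s /= s0 <-]; split=> [|x].
  by apply/symmetricmxP; rewrite linearZ /= trmx_delta.
by rewrite -/(qform _ _) qformZ qform_E00 mulr_ge0 ?sqr_ge0.
Qed.

(** Reading the ray off the diagonal turns the face property into a fact about sums of nonnegative
    numbers. *)
Lemma rayP Y : ray Y <-> psd Y /\ forall i, i != ord0 -> Y i i = 0.
Proof.
split=> [rY|[pY Yd]].
  split; first exact: ray_psd.
  by case: rY => s _ <- i /negPf i0; rewrite !mxE i0 mulr0.
exists (Y ord0 ord0); first exact: psd_diag_ge0.
by rewrite -psd_supported0.
Qed.

Lemma ray_face : face (@psd R n1) ray.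
Proof.
split; first exact: ray_psd.
- move=> X Y t; rewrite !inE => -[a /= a0 <-] [b /= b0 <-].
  exists (t%:num * a + (1 - t%:num) * b); last first.
    by rewrite scalerDl -!scalerA.
  by rewrite /= addr_ge0 ?mulr_ge0 // subr_ge0.
move=> X Y t pX pY t0 t1 /rayP[_ d0].
suff d i : i != ord0 -> X i i = 0 /\ Y i i = 0.
  by split; apply/rayP; split=> // i /d[].
move=> /d0; rewrite !mxE => /eqP.
have t1' : 0 < 1 - t by rewrite subr_gt0.
rewrite paddr_eq0 ?mulr_ge0 ?psd_diag_ge0 ?(ltW t0) ?(ltW t1') //.
by rewrite !mulf_eq0 (gt_eqF t0) (gt_eqF t1') /= => /andP[/eqP-> /eqP->].
Qed.

Lemma minimal_face_Lset : minimal_face L = ray.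
Proof.
rewrite /minimal_face feasible_Lset; apply/seteqP; split.
  apply: smallest_sub; first exact: ray_face.
  by move=> _ ->; exists 1; rewrite ?scale1r //=.
move=> _ [s /= s0 <-] F [[_ _ fF] E00F].
(* E00 lies strictly between s E00 and u E00. *)
pose t := (s + 2)^-1; pose u := 2 / (s + 1).
have t0 : 0 < t by rewrite invr_gt0; lra.
have t1 : t < 1 by rewrite invf_lt1; lra.
have u0 : 0 <= u by rewrite divr_ge0; lra.
apply: (fF _ (u *: E00) t _ _ t0 t1 _).1.
- by apply: ray_psd; exists s.
- by apply: ray_psd; exists u.
rewrite !scalerA -scalerDl (_ : _ + _ = 1) ?scale1r; first exact: E00F.
by rewrite /t /u; field; rewrite !gt_eqF //; lra.
Qed.

Lemma minimal_face_xv : ~ minimal_face L (xv *m xv^T).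
Proof.
rewrite minimal_face_Lset => /rayP[_ /(_ _ ord_max_neq0)].
rewrite outerE xv_max => /eqP; rewrite mulf_eq0 orbb.
by rewrite oppr_eq0 oner_eq0.
Qed.

(** * Failure of Slater's condition *)

Lemma not_slater_Lset : ~ slater L.
Proof.
move=> [X [LX pX]]; have : feasible L X by split=> //; exact: posdef_psd.
rewrite feasible_Lset => /= XE; case: pX => _ /(_ _ xv_neq0).
by rewrite -/(qform _ _) XE qform_E00 xv_ord0 expr0n ltxx.
Qed.

(** A positive definite [Q] would lift to a feasible point, hence to [E00], whose form vanishes at
    [xv]; but that value is the form of [Q] at the nonzero vector [V^T *m xv]. *)
Lemma not_slater_reduced r (V : 'M[R]_(n1, r)) (y : 'cV[R]_r) :
  xv = V *m y -> ~ slater (reduced L V).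
Proof.
move=> xVy [Q [[sQ LQ] pQ]].
have : feasible L (V *m Q *m V^T).
  split=> //; rewrite -{1}[V]trmxK; apply: psd_congr; exact: posdef_psd.
rewrite feasible_Lset => /= QE.
(* Otherwise [xv^T *m xv = y^T *m (V^T *m xv)] would be zero. *)
have z0 : V^T *m xv != 0.
  apply/eqP => z0; have := sqnorm_gt0 xv_neq0.
  by rewrite {1}xVy trmx_mul -mulmxA z0 mulmx0 mxE ltxx.
case: pQ => _ /(_ _ z0); rewrite -/(qform _ _) -qform_congr trmxK QE.
by rewrite qform_E00 xv_ord0 expr0n ltxx.
Qed.

(** * The lower bound: one step is not enough *)

Definition yv : 'M[R]_n1 :=
  let d := \col_i (xv i 0 ^+ 2) in
  xv *m xv^T + E00 + (e0 *m d^T + d *m e0^T).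

Lemma yvE i j : yv i j = xv i 0 * xv j 0 + (i == ord0)%:R * (j == ord0)%:R
  + ((i == ord0)%:R * xv j 0 ^+ 2 + xv i 0 ^+ 2 * (j == ord0)%:R).
Proof. by rewrite !mxE !big_ord1 !mxE !andbT -natrM mulnb. Qed.

Lemma qform_yv (x : 'cV[R]_n1) : x ord0 0 = 0 ->
  qform yv x = (xv^T *m x) 0 0 ^+ 2.
Proof.
move=> x0; rewrite /yv !qformD qform_outer qform_E00.
rewrite x0 expr0n addr0 -[RHS]addr0.
have xe : x^T *m e0 = 0.
  by apply/matrixP => i j; rewrite !ord1 -colE !mxE.
have ex : e0^T *m x = 0 by rewrite -[x]trmxK -trmx_mul xe trmx0.
congr (_ + _); rewrite /qform !mulmxA xe -2!mulmxA ex.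
by rewrite !mul0mx !mulmx0 mxE addr0.
Qed.

Lemma Lset_yv : L yv.
Proof.
apply/LsetP; split.
- by apply/matrixP => i j; rewrite mxE !yvE; ring.
- by rewrite yvE xv_ord0 eqxx /=; ring.
- by move=> i /negPf i0; rewrite !yvE xv_ord0 i0 eqxx /=; ring.
- move=> j; rewrite qform_yv ?qv_ord0 // (_ : _ *m _ = 0) ?mxE ?expr0n //.
  apply: trmx_inj; rewrite trmx_mul trmxK trmx0; apply/matrixP => a b.
  by rewrite !ord1 qv_xv mxE.
Qed.

(** Besides the lower bound, this serves the two-step construction: it puts [xv] in the range of
    [V], so that Slater's condition still fails after the first step and [expose2] is nonzero. *)
Lemma exposing_ker_xv W : orthosym L W -> psd W -> W *m xv = 0.
Proof.
move=> [_ WL] pW.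
have W0 : W *m e0 = 0.
  apply: psd_ker => //; rewrite -(WL _ Lset_E00) E00E.
  by rewrite mxdot_outer2.
have W0' : e0^T *m W = 0 by rewrite -(psd_sym pW) -trmx_mul W0 trmx0.
apply: psd_ker => //; rewrite -(WL _ Lset_yv) /yv !mxdotD (WL _ Lset_E00).
rewrite !mxdot_outer2 W0' -[_ *m W *m e0]mulmxA W0 mulmx0 mul0mx.
by rewrite -/(qform _ _) !mxE !addr0.
Qed.

Lemma fr_face1_xv F : fr_face 1 L F -> F (xv *m xv^T).
Proof.
move=> [r [V [G [[_ [W [_ WL pW kV]]] /= -> ->]]]].
have [y xVy] := ker_basis_lift kV (exposing_ker_xv WL pW).
exists (y *m y^T); first exact: psd_outer.
by rewrite xVy trmx_mul !mulmxA.
Qed.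

(** * The first exposing matrix *)

Definition expose1 : 'M[R]_n1 := \sum_j qv j *m (qv j)^T.

Lemma qform_expose1 x : qform expose1 x = \sum_j ((qv j)^T *m x) 0 0 ^+ 2.
Proof.
rewrite /expose1; elim/big_rec2: _ => [|j a b _ IH]; first exact: qform0.
by rewrite qformD IH qform_outer.
Qed.

Lemma psd_expose1 : psd expose1.
Proof.
split=> [|x]; last first.
  by rewrite -/(qform _ _) qform_expose1 sumr_ge0 // => j _; exact: sqr_ge0.
apply/symmetricmxP; rewrite linear_sum /=; apply: eq_bigr => j _.
by rewrite trmx_mul trmxK.
Qed.

Lemma orthosym_expose1 : orthosym L expose1.
Proof.
split=> [|X /LsetP[_ _ _ Xq]]; first by case: psd_expose1.
rewrite /mxdot mulmx_suml linear_sum big1 //= => j _.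
by rewrite -/(mxdot _ _) mxdot_outer.
Qed.

Lemma expose1_neq0 : expose1 != 0.
Proof.
apply/eqP => W10.
have qe : qform expose1 (delta_mx ord_max 0) = 0 by rewrite W10 qform0.
have [k qk] := qv_cover ord_max_neq0.
move: qe; rewrite qform_expose1 => s0.
have /eqP := sumr_ge0_eq0 (fun=> sqr_ge0 _) s0 k.
by rewrite sqrf_eq0 dot_delta gt_eqF.
Qed.

Lemma expose1_ker (x : 'cV[R]_n1) j : expose1 *m x = 0 -> ((qv j)^T *m x) 0 0 = 0.
Proof.
move=> W1x; have : qform expose1 x = 0 by rewrite /qform -mulmxA W1x mulmx0 mxE.
rewrite qform_expose1 => s0.
by have /eqP := sumr_ge0_eq0 (fun=> sqr_ge0 _) s0 j; rewrite sqrf_eq0 => /eqP.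
Qed.

Lemma expose1_e0 : expose1 *m e0 = 0.
Proof.
apply: psd_ker; first exact: psd_expose1.
rewrite qform_expose1 big1 // => j _.
by rewrite dot_delta qv_ord0 expr0n.
Qed.

(** * The second exposing matrix *)

Section SecondStep.
Variables (r : nat) (V : 'M[R]_(n1, r)) (y0 : 'cV[R]_r).
Hypotheses (kV : ker_basis expose1 V) (Vy0 : e0 = V *m y0).

Definition expose2 : 'M[R]_r := V^T *m diag_mx csum *m V.

Lemma psd_expose2 : psd expose2.
Proof. exact/psd_congr/psd_diag/csum_ge0. Qed.

Lemma qform_expose2 (y : 'cV[R]_r) :
  qform expose2 y = \sum_i csum 0 i * (V *m y) i 0 ^+ 2.
Proof. by rewrite qform_congr qform_diag. Qed.

Lemma expose2_ker (y : 'cV[R]_r) : expose2 *m y = 0 ->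
  forall i, i != ord0 -> (V *m y) i 0 = 0.
Proof.
move=> W2y i i0.
have : qform expose2 y = 0 by rewrite /qform -mulmxA W2y mulmx0 mxE.
rewrite qform_expose2 => s0.
have p k : 0 <= csum 0 k * (V *m y) k 0 ^+ 2.
  by rewrite mulr_ge0 ?csum_ge0 ?sqr_ge0.
have /eqP := sumr_ge0_eq0 p s0 i.
by rewrite mulf_eq0 gt_eqF ?csum_gt0 //= sqrf_eq0 => /eqP.
Qed.

(** The columns of [V] lie in the kernel of [expose1]. Hence every lifted [V *m Q *m V^T] kills each
    [qv j], even when [Q] is not semidefinite, as orthogonality to the whole reduced affine space
    demands. *)
Lemma trmx_V_qv j : V^T *m qv j = 0.
Proof.
apply: trmx_inj; rewrite trmx_mul trmxK trmx0; apply/matrixP => i k.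
rewrite !ord1 [RHS]mxE -(expose1_ker (x := V *m delta_mx k 0) j); last first.
  by rewrite mulmxA (ker_basis_mul kV) mul0mx.
by rewrite mulmxA -colE [RHS]mxE.
Qed.

Lemma orthosym_expose2 : orthosym (reduced L V) expose2.
Proof.
split=> [|Q [_ LQ]]; first by case: psd_expose2.
rewrite mxdot_congr; apply: mxdot_csum => // j.
by rewrite -mulmxA trmx_V_qv mulmx0.
Qed.

Lemma ker_basis_expose2 : ker_basis expose2 y0.
Proof.
have y0n : y0 != 0.
  apply/eqP => y00; have /matrixP/(_ ord0 0) := Vy0.
  by rewrite y00 mulmx0 !mxE !eqxx => /eqP; rewrite oner_eq0.
split; first by rewrite /row_free rank_rV trmx_eq0 y0n.
apply/andP; split.
  (* [y0] is in the kernel because [V *m y0 = e0] and [csum] vanishes at index 0. *)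
  rewrite sub_kermx -trmx_mul trmx_eq0 -!mulmxA -Vy0 mul_diag_mx.
  apply/eqP; rewrite (_ : \matrix_(_, _) _ = 0) ?mulmx0 //.
  apply/matrixP => i j; rewrite mxE [delta_mx _ _ _ _]mxE [RHS]mxE.
  by case: eqP => [->|_]; rewrite ?mulr0 // csum_ord0 mul0r.
apply/row_subP => k; set u := row k _.
have W2u : expose2 *m u^T = 0.
  apply: trmx_inj; rewrite trmx_mul trmxK trmx0 /u -row_mul mulmx_ker.
  by rewrite row0.
(* A lifted kernel vector is supported at index 0, so it is a multiple of [e0 = V *m y0];
   injectivity of [V] then makes [u^T] a multiple of [y0]. *)
have Vu : V *m u^T = V *m ((V *m u^T) ord0 0 *: y0).
  rewrite -scalemxAr -Vy0; apply/matrixP => i j.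
  rewrite ord1 [RHS]mxE [delta_mx _ _ _ _]mxE eqxx andbT.
  by have [->|/(expose2_ker W2u)->] := eqVneq i ord0; rewrite ?mulr1 ?mulr0.
rewrite -[u]trmxK (ker_basis_inj kV Vu) linearZ /=.
exact: scalemx_sub.
Qed.

Lemma expose2_neq0 (y : 'cV[R]_r) : xv = V *m y -> expose2 != 0.
Proof.
move=> xVy; apply/eqP => W20.
have := expose2_ker (y := y) _ ord_max_neq0; rewrite W20 mul0mx -xVy xv_max.
by move=> /(_ erefl)/eqP; rewrite oppr_eq0 oner_eq0.
Qed.

End SecondStep.

(** * Two steps reach the minimal face *)

Lemma ray_image r (V : 'M[R]_(n1, r)) (y0 : 'cV[R]_r) : e0 = V *m y0 ->
  ray = [set V *m Q *m V^T | Q in [set y0 *m Q *m y0^T | Q in @psd R 1]].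
Proof.
move=> Vy0.
have E a : V *m (y0 *m a%:M *m y0^T) *m V^T = a *: E00.
  rewrite !mulmxA -Vy0 -mulmxA -trmx_mul -Vy0 mul_mx_scalar -scalemxAl.
  by rewrite trmx_delta mul_delta_mx.
apply/seteqP; split=> [_ [s /= s0 <-]|_ [_ [Q pQ <-] <-]].
  exists (y0 *m s%:M *m y0^T) => //; exists s%:M => //.
  by rewrite -diag_const_mx; apply: psd_diag => i; rewrite mxE.
exists (Q 0 0); first exact: psd_diag_ge0.
by rewrite -E -mx11_scalar.
Qed.

Lemma fr_face2_Lset : fr_face 2 L (minimal_face L).
Proof.
have [r [V kV]] := ker_basis_exists expose1.
have [y0 Vy0] := ker_basis_lift kV expose1_e0.
have [y xVy] := ker_basis_lift kV (exposing_ker_xv orthosym_expose1 psd_expose1).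
exists r, V, [set y0 *m Q *m y0^T | Q in @psd R 1]; split.
- split; first exact: not_slater_Lset.
  by exists expose1; split=> //;
    [exact: expose1_neq0 | exact: orthosym_expose1 | exact: psd_expose1].
- exists 1%N, y0, (@psd R 1); split=> //.
  split; first exact: not_slater_reduced xVy.
  exists (expose2 V); split; [exact: expose2_neq0 xVy | exact: orthosym_expose2
    | exact: psd_expose2 | exact: ker_basis_expose2].
- by rewrite minimal_face_Lset; exact: ray_image.
Qed.

Lemma singularity_degree_Lset : has_singularity_degree L 2.
Proof.
split; first exact: Lset_affine.
- by rewrite feasible_Lset; exists E00.
- exact: fr_face2_Lset.
(* With no step the face is the whole cone; with one step [fr_face1_xv] applies. Both contain
   [xv *m xv^T]. *)
move=> [|[|//]] h; exfalso; apply: minimal_face_xv.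
  by rewrite h; exact: psd_outer.
exact: fr_face1_xv.
Qed.

End Relaxation.

Theorem lemma4p1 (R : realType) (m : nat) (hm : (1 <= m)%N) :
  @has_singularity_degree R (2 * m).+1 (@Lset R m) 2.
Proof. exact: singularity_degree_Lset. Qed.
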